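(* Let $\alpha\in(0,2)$, let $D\subset\mathbb{R}^d$ be a bounded domain and let $\lambda>0$. Let $f\colon\mathbb{R}\to\mathbb{R}$ be a non-zero function (i.e. $f\not\equiv 0$) satisfying $$(-\Delta_y)^{\alpha/2}f(y)=\lambda f(y)\qquad\text{for all } y\in\mathbb{R}.$$ Let $u\colon\mathbb{R}^d\to\mathbb{R}$ be a function for which $(-\Delta_{x_i})^{\alpha/2}u(\mathbf{x})$ is well defined for every $\mathbf{x}\in D$ and $i=1,\dots,d$, and set $v(\mathbf{x},y)=u(\mathbf{x})f(y)$ for $(\mathbf{x},y)\in\mathbb{R}^d\times\mathbb{R}$. Define $$\mathcal{A}^{\alpha}_{\mathbf{x},y}:=A^{\alpha}_{\mathbf{x}}-(-\Delta_y)^{\alpha/2}.$$ Then $$\mathcal{A}^{\alpha}_{\mathbf{x},y}v(\mathbf{x},y)=0\quad\text{for all }(\mathbf{x},y)\in D\times\mathbb{R}$$ if and only if $$A^{\alpha}_{\mathbf{x}}u(\mathbf{x})=\lambda u(\mathbf{x})\quad\text{for all }\mathbf{x}\in D.$$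
   Context: Let $\alpha\in(0,2)$ and $$C_\alpha=\frac{2^\alpha\,\Gamma((1+\alpha)/2)}{\pi^{1/2}\,|\Gamma(-\alpha/2)|}.$$ For a function $h\colon\mathbb{R}\to\mathbb{R}$ the one-dimensional fractional Laplacian is the pointwise singular (principal value) integral $$(-\Delta)^{\alpha/2}h(s)=C_\alpha\,\mathrm{p.v.}\!\int_{-\infty}^{\infty}\frac{h(s)-h(t)}{|s-t|^{1+\alpha}}\,dt .$$ For a function of several variables, $(-\Delta_{x_i})^{\alpha/2}$ (respectively $(-\Delta_y)^{\alpha/2}$) denotes this operator acting in the single variable $x_i$ (respectively $y$) with all other variables frozen. ''Well defined'' at a point means that the corresponding principal value integral exists and is finite. The nonisotropic fractional Laplacian on $\mathbb{R}^d$ is $$A^\alpha_{\mathbf{x}}=\sum_{i=1}^d-(-\Delta_{x_i})^{\alpha/2},\qquad \mathbf{x}=(x_1,\dots,x_d).$$ *)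

(* Defs.v *)
From mathcomp Require Import all_boot all_order all_algebra.
From mathcomp Require Import all_classical all_reals all_analysis.

Set Implicit Arguments.
Unset Strict Implicit.
Unset Printing Implicit Defensive.

Import Order.TTheory GRing.Theory Num.Theory.
Import numFieldNormedType.Exports.

Local Open Scope classical_set_scope.
Local Open Scope ring_scope.

(* Euler's integral for 0 < z; for other z, the value forced by
   Gamma (z + n) = z (z + 1) ... (z + n - 1) Gamma z, with n the least natural
   number such that 0 < z + n (the junk value at a pole is 0). *)
Definition Gamma_integral {R : realType} (z : R) : R :=
  Rintegral lebesgue_measure `]0, +oo[ (fun t : R => t `^ (z - 1) * expR (- t)).

Definition Gamma {R : realType} (z : R) : R :=
  if 0 < z then Gamma_integral z
  else let n := (Num.truncn (- z)).+1 in
       Gamma_integral (z + n%:R) / \prod_(k < n) (z + k%:R).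

Definition fracLap_const {R : realType} (alpha : R) : R :=
  2 `^ alpha * Gamma ((1 + alpha) / 2) /
    (pi `^ 2^-1 * `|Gamma (- alpha / 2)|).

Definition fracLap_integrand {R : realType} (alpha : R) (h : R -> R) (s t : R) : R :=
  (h s - h t) / `|s - t| `^ (1 + alpha).

(* [completed_lebesgue_measure] rather than [lebesgue_measure]: the latter only
   lives on the Borel sigma-algebra and would force [h] to be Borel. *)
Definition fracLap_trunc {R : realType} (alpha : R) (h : R -> R) (s eps : R) : R :=
  Rintegral (@completed_lebesgue_measure R) [set t : R | eps < `|s - t|]
    (fracLap_integrand alpha h s).

(* The truncated integrals are absolutely convergent Lebesgue integrals, and
   they have a finite limit as the excised interval shrinks to the point s. *)
Definition fracLap_defined {R : realType} (alpha : R) (h : R -> R) (s : R) : Prop :=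
  (forall eps : R, 0 < eps ->
     (@completed_lebesgue_measure R).-integrable [set t : R | eps < `|s - t|]
       (EFin \o fracLap_integrand alpha h s)) /\
  cvg (fracLap_trunc alpha h s eps @[eps --> 0^'+]).

Definition fracLap {R : realType} (alpha : R) (h : R -> R) (s : R) : R :=
  fracLap_const alpha * lim (fracLap_trunc alpha h s eps @[eps --> 0^'+]).

Definition set_coord {R : realType} (d : nat) (x : 'rV[R]_d) (i : 'I_d) (t : R) :
    'rV[R]_d :=
  \row_j (if j == i then t else x 0 j).

Definition fracLap_coord_defined {R : realType} (d : nat) (alpha : R) (i : 'I_d)
    (u : 'rV[R]_d -> R) (x : 'rV[R]_d) : Prop :=
  fracLap_defined alpha (fun t => u (set_coord x i t)) (x 0 i).

Definition fracLap_coord {R : realType} (d : nat) (alpha : R) (i : 'I_d)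
    (u : 'rV[R]_d -> R) (x : 'rV[R]_d) : R :=
  fracLap alpha (fun t => u (set_coord x i t)) (x 0 i).

Definition nonisoLap_defined {R : realType} (d : nat) (alpha : R)
    (u : 'rV[R]_d -> R) (x : 'rV[R]_d) : Prop :=
  forall i : 'I_d, fracLap_coord_defined alpha i u x.

Definition nonisoLap {R : realType} (d : nat) (alpha : R)
    (u : 'rV[R]_d -> R) (x : 'rV[R]_d) : R :=
  \sum_(i < d) - fracLap_coord alpha i u x.

Definition extLap_defined {R : realType} (d : nat) (alpha : R)
    (w : 'rV[R]_d * R -> R) (p : 'rV[R]_d * R) : Prop :=
  nonisoLap_defined alpha (fun x => w (x, p.2)) p.1 /\
  fracLap_defined alpha (fun y => w (p.1, y)) p.2.

Definition extLap {R : realType} (d : nat) (alpha : R)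
    (w : 'rV[R]_d * R -> R) (p : 'rV[R]_d * R) : R :=
  nonisoLap alpha (fun x => w (x, p.2)) p.1 - fracLap alpha (fun y => w (p.1, y)) p.2.

(* Main.v *)
Require Import Defs.
From mathcomp Require Import all_boot all_order all_algebra.
From mathcomp Require Import all_classical all_reals all_analysis.
From mathcomp Require Import measurable_realfun.

Import Order.TTheory GRing.Theory Num.Theory.
Import numFieldNormedType.Exports.

Local Open Scope classical_set_scope.
Local Open Scope ring_scope.

(** The fractional Laplacian is homogeneous in the function it acts on: where the
    Laplacian of [h] is well defined, so is the Laplacian of [c * h], and it is
    [c] times as large ([fracLap_definedZ], [fracLapZ]).  Indeed the factor [c]
    comes out of the difference quotient, then out of each truncated integral,
    then out of the limit.

    For a product [v (x, y) = u x * f y] and frozen [y], the function [v (_, y)]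
    is the multiple [f y * u] of [u]; for frozen [x], the function [v (x, _)] is
    the multiple [u x * f] of [f].  Hence the extended operator is well defined
    on [v] wherever the operators acting on [u] and on [f] are, and
      [extLap alpha v (x, y) = f y * nonisoLap alpha u x - u x * fracLap alpha f y]
    ([extLap_separated]).  When [f] is an eigenfunction for [lambda], the
    right-hand side is [f y * (nonisoLap alpha u x - lambda * u x)].  It vanishes
    as soon as [u] satisfies its own eigenvalue equation; conversely, if it
    vanishes for all [y], then it does so at a point [y] where [f y] is not zero,
    and the second factor must be zero. *)

(** Linearity of the truncated integrals needs a domain that is measurable for
    the Lebesgue sigma-algebra, which the completed measure lives on; the
    domain is open, hence Borel. *)
Lemma excised_ball_measurable {R : realType} (s eps : R) :
  (@wlength R idfun)^*%mu.-cara.-measurable [set t : R | eps < `|s - t|].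
Proof.
apply: sub_caratheodory; apply: open_measurable.
apply: (@open_comp _ _ (fun t : R => `|s - t|) [set r | eps < r]).
  by move=> t _; apply: cvg_norm; apply: cvgB; [exact: cvg_cst | exact: cvg_id].
exact: open_gt.
Qed.

Lemma fracLap_integrandZ {R : realType} (alpha c : R) (h : R -> R) (s t : R) :
  fracLap_integrand alpha (fun t => c * h t) s t =
  c * fracLap_integrand alpha h s t.
Proof. by rewrite /fracLap_integrand -mulrBr mulrA. Qed.

Lemma fracLap_truncZ {R : realType} (alpha c : R) (h : R -> R) (s eps : R) :
  (@completed_lebesgue_measure R).-integrable [set t : R | eps < `|s - t|]
    (EFin \o fracLap_integrand alpha h s) ->
  fracLap_trunc alpha (fun t => c * h t) s eps = c * fracLap_trunc alpha h s eps.
Proof.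
move=> h_int; rewrite /fracLap_trunc -RintegralZl //.
  by apply: eq_Rintegral => t _; exact: fracLap_integrandZ.
exact: excised_ball_measurable.
Qed.

(** The truncated integrals of [c * h] and [c] times those of [h] agree only for
    positive radii, which is enough for a limit at [0] from the right. *)
Lemma cvg_fracLap_truncZ {R : realType} (alpha c : R) (h : R -> R) (s : R) :
  fracLap_defined alpha h s ->
  fracLap_trunc alpha (fun t => c * h t) s eps @[eps --> 0^'+] -->
  c * lim (fracLap_trunc alpha h s eps @[eps --> 0^'+]).
Proof.
move=> [h_int h_cvg].
have cE : \forall eps \near 0^'+, c * fracLap_trunc alpha h s eps =
    fracLap_trunc alpha (fun t => c * h t) s eps.
  near=> eps; rewrite fracLap_truncZ //; apply: h_int.
  by near: eps; exact: nbhs_right_gt.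
apply: cvg_trans (near_eq_cvg cE) _.
exact: cvgMl_tmp.
Unshelve. all: by end_near.
Qed.

Lemma fracLap_definedZ {R : realType} (alpha c : R) (h : R -> R) (s : R) :
  fracLap_defined alpha h s -> fracLap_defined alpha (fun t => c * h t) s.
Proof.
move=> h_def; split=> [eps eps_gt0|]; last first.
  by apply/cvg_ex; eexists; exact: cvg_fracLap_truncZ h_def.
rewrite (_ : _ \o _ =
    (fun t => c%:E * (EFin \o fracLap_integrand alpha h s) t)%E).
  apply: integrableZl; first exact: excised_ball_measurable.
  exact: h_def.1.
by apply/funext => t /=; rewrite fracLap_integrandZ EFinM.
Qed.

Lemma fracLapZ {R : realType} (alpha c : R) (h : R -> R) (s : R) :
  fracLap_defined alpha h s ->
  fracLap alpha (fun t => c * h t) s = c * fracLap alpha h s.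
Proof.
move=> h_def; rewrite /fracLap mulrCA; congr (_ * _).
exact/cvg_lim/cvg_fracLap_truncZ.
Qed.

Lemma nonisoLap_definedZ {R : realType} (d : nat) (alpha c : R)
    (u : 'rV[R]_d -> R) (x : 'rV[R]_d) :
  nonisoLap_defined alpha u x -> nonisoLap_defined alpha (fun x => c * u x) x.
Proof. by move=> u_def i; exact: fracLap_definedZ (u_def i). Qed.

Lemma nonisoLapZ {R : realType} (d : nat) (alpha c : R)
    (u : 'rV[R]_d -> R) (x : 'rV[R]_d) :
  nonisoLap_defined alpha u x ->
  nonisoLap alpha (fun x => c * u x) x = c * nonisoLap alpha u x.
Proof.
move=> u_def; rewrite /nonisoLap mulr_sumr; apply: eq_bigr => i _.
by rewrite mulrN; congr (- _); exact: fracLapZ (u_def i).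
Qed.

Lemma extLap_separated {R : realType} (d : nat) (alpha : R)
    (u : 'rV[R]_d -> R) (f : R -> R) (x : 'rV[R]_d) (y : R) :
  nonisoLap_defined alpha u x -> fracLap_defined alpha f y ->
  extLap_defined alpha (fun p => u p.1 * f p.2) (x, y) /\
  extLap alpha (fun p => u p.1 * f p.2) (x, y) =
    f y * nonisoLap alpha u x - u x * fracLap alpha f y.
Proof.
move=> u_def f_def; rewrite /extLap_defined /extLap /=.
have -> : (fun x => u x * f y) = (fun x => f y * u x).
  by apply/funext => z; rewrite mulrC.
split; first by split; [exact: nonisoLap_definedZ | exact: fracLap_definedZ].
by rewrite nonisoLapZ // fracLapZ.
Qed.

Theorem theorem2p1 (R : realType) (d : nat) (d_gt0 : (0 < d)%N)
    (alpha : R) (alpha_gt0 : 0 < alpha) (alpha_lt2 : alpha < 2)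
    (D : set 'rV[R]_d) (D_neq0 : D !=set0) (D_open : open D)
    (D_conn : connected D) (D_bounded : bounded_set D)
    (lambda : R) (lambda_gt0 : 0 < lambda)
    (f : R -> R) (f_neq0 : exists y : R, f y != 0)
    (f_eigen : forall y : R,
       fracLap_defined alpha f y /\ fracLap alpha f y = lambda * f y)
    (u : 'rV[R]_d -> R)
    (u_def : forall x : 'rV[R]_d, D x ->
       forall i : 'I_d, fracLap_coord_defined alpha i u x)
    (v : 'rV[R]_d * R -> R)
    (v_def : forall (x : 'rV[R]_d) (y : R), v (x, y) = u x * f y) :
  (forall (x : 'rV[R]_d) (y : R), D x ->
     extLap_defined alpha v (x, y) /\ extLap alpha v (x, y) = 0)
  <->
  (forall x : 'rV[R]_d, D x -> nonisoLap alpha u x = lambda * u x).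
Proof.
have -> : v = (fun p => u p.1 * f p.2) by apply/funext => -[x y]; exact: v_def.
have vE x y : D x -> extLap_defined alpha (fun p => u p.1 * f p.2) (x, y) /\
    extLap alpha (fun p => u p.1 * f p.2) (x, y) =
    f y * (nonisoLap alpha u x - lambda * u x).
  move=> Dx; have [f_def fE] := f_eigen y.
  have [v_ok ->] := extLap_separated d alpha u f x y (u_def x Dx) f_def.
  by split=> //; rewrite fE mulrBr [u x * _]mulrC mulrAC [_ * f y]mulrC.
split=> [v_harm x Dx|u_eigen x y Dx].
  have [y fy_neq0] := f_neq0.
  have [_ /eqP] := v_harm x y Dx.
  by rewrite (vE x y Dx).2 mulf_eq0 (negbTE fy_neq0) subr_eq0 => /eqP.
have [v_ok ->] := vE x y Dx.
by split=> //; rewrite u_eigen // subrr mulr0.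
Qed.
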